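(* Let $C$ be the graph consisting of a single vertex $v$, and let $P$ be any graph with $r(P)\geq 2$. Then $A_{ucg}(C,P)=0$.
   Context: All graphs are finite and simple. $d(u,v)$ denotes the distance between vertices $u,v$ ($\infty$ if there is no path). The eccentricity of $v$ is $e(v)=\max_u d(u,v)$; the radius $r(G)$ is the minimum eccentricity and the diameter $\mathrm{diam}(G)$ the maximum eccentricity of vertices of $G$. For a graph $H$: the center $Z(H)$ is the set of vertices of minimum eccentricity; $EC(v)=\{x: d(v,x)=e(v)\}$; the centered periphery is $CP(H)=\bigcup_{z\in Z(H)} EC(z)$; $\langle S\rangle$ denotes the subgraph induced by a vertex set $S$. $H$ is a uniform central graph (UCG) if $EC(c)$ is the same set for all $c\in Z(H)$. The intermediate vertices are $I(H)=V(H)\setminus (Z(H)\cup CP(H))$. For graphs $C,P$, the central-peripheral appendage number $A_{ucg}(C,P)$ is the minimum of $|I(H)|$ over all UCGs $H$ with $\langle Z(H)\rangle\cong C$ and $\langle CP(H)\rangle\cong P$, and is $\infty$ if no such $H$ exists. *)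

(* Defs.v *)
From HB Require Import structures.
From mathcomp Require Import all_boot.
From mathcomp Require Import boolp classical_sets.

Set Implicit Arguments.
Unset Strict Implicit.
Unset Printing Implicit Defensive.

Local Open Scope nat_scope.

Inductive enat := Fin of nat | Infty.

Definition option_of_enat (a : enat) : option nat :=
  if a is Fin n then Some n else None.

Definition enat_of_option (o : option nat) : enat :=
  if o is Some n then Fin n else Infty.

Lemma option_of_enatK : cancel option_of_enat enat_of_option.
Proof. by case. Qed.

HB.instance Definition _ := Equality.copy enat (can_type option_of_enatK).

Definition ele (a b : enat) : bool :=
  match a, b with
  | _, Infty => true
  | Infty, Fin _ => false
  | Fin m, Fin n => m <= n
  end.

Definition emax (a b : enat) : enat := if ele a b then b else a.

Definition emin (a b : enat) : enat := if ele a b then a else b.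

(* The minimum of a set of natural numbers, and Infty if the set is empty. *)
Definition min_set (A : set nat) : enat :=
  if pselect (exists n, `[< A n >]) is left exA then Fin (ex_minn exA)
  else Infty.

(* The vertex set may be empty, so that every vertex set induces a graph. *)
Record sgraph := SGraph {
  vertex :> finType;
  adj : rel vertex;
  adj_sym : symmetric adj;
  adj_irrefl : irreflexive adj
}.

Definition iso (G H : sgraph) : Prop :=
  exists f : G -> H, bijective f /\ forall x y, adj (f x) (f y) = adj x y.

Section Induced.
Variables (G : sgraph) (S : {set G}).

Definition induced_adj : rel {x : G | x \in S} :=
  fun x y => adj (val x) (val y).

Lemma induced_adj_sym : symmetric induced_adj.
Proof. by move=> x y; apply: adj_sym. Qed.

Lemma induced_adj_irrefl : irreflexive induced_adj.
Proof. by move=> x; apply: adj_irrefl. Qed.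

Definition induced : sgraph := SGraph induced_adj_sym induced_adj_irrefl.

End Induced.

Section Eccentricity.
Variable G : sgraph.

(* The walk p omits its starting vertex u, so size p counts its edges. *)
Definition dist (u v : G) : enat :=
  min_set (fun n => exists p : seq G,
    [/\ path (@adj G) u p, last u p = v & size p = n]).

Definition ecc (v : G) : enat := \big[emax/Fin 0]_(u : G) dist u v.

(* Meaningful only for a nonempty graph: it is Infty on the empty one. *)
Definition radius : enat := \big[emin/Infty]_(v : G) ecc v.

Definition center : {set G} := [set v | ecc v == radius].

Definition EC (v : G) : {set G} := [set x | dist v x == ecc v].

Definition CP : {set G} := \bigcup_(z in center) EC z.

Definition intermediate : {set G} := ~: (center :|: CP).

Definition ucg : Prop := {in center &, forall c c', EC c = EC c'}.

End Eccentricity.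

Definition A_ucg (C P : sgraph) : enat :=
  min_set (fun k => exists H : sgraph,
    [/\ ucg H, iso (induced (center H)) C, iso (induced (CP H)) P
      & #|intermediate H| = k]).

(* Main.v *)
Require Import Defs.
From HB Require Import structures.
From mathcomp Require Import all_boot.
From mathcomp Require Import boolp.

Set Implicit Arguments.
Unset Strict Implicit.
Unset Printing Implicit Defensive.

(** The witness is the cone over [P].  Its apex has eccentricity 1; since
    [r(P) >= 2], every vertex of [P] has a non-neighbour in [P], hence
    eccentricity at least 2 in the cone.  So the center is the apex alone, its
    eccentric vertices are exactly those of [P], and none is intermediate. *)

Lemma ele_trans : transitive ele.
Proof. by case=> [n|] [m|] [p|] //=; apply: leq_trans. Qed.

Lemma ele_anti : antisymmetric ele.
Proof.
by case=> [m|] [n|] //=; rewrite ?andbF // -eqn_leq => /eqP ->.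
Qed.

Lemma ele_total : total ele.
Proof. by case=> [m|] [n|] //=; apply: leq_total. Qed.

(** Trades lower bounds for negated upper bounds, which turns a statement about all vertices into
    one about some vertex. *)
Lemma ele_Fin_succ n a : ele (Fin n.+1) a = ~~ ele a (Fin n).
Proof. by case: a => [m|] //=; rewrite ltnNge. Qed.

Lemma ele_emin a b c : ele c (emin a b) = ele c a && ele c b.
Proof.
rewrite /emin; case: ifP => ab; apply/idP/andP => [h|[] //]; split=> //.
  exact: ele_trans h ab.
by apply: ele_trans h _; have := ele_total a b; rewrite ab.
Qed.

Lemma emax_ele a b c : ele (emax a b) c = ele a c && ele b c.
Proof.
rewrite /emax; case: ifP => ab; apply/idP/andP => [h|[] //]; split=> //.
  exact: ele_trans ab h.
by apply: ele_trans h; have := ele_total a b; rewrite ab.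
Qed.

(** Also covers empty [A]: the minimum is then [Infty] and both sides hold. *)
Lemma ele_min_set A k :
  ele (Fin k) (min_set A) <-> (forall n, A n -> k <= n).
Proof.
rewrite /min_set; case: pselect => [exA|nA]; last first.
  by split=> // _ n An; case: nA; exists n; apply/asboolP.
case: ex_minnP => m /asboolP Am min_m; split=> /= [km n An|]; last exact.
by apply: leq_trans km (min_m _ _); apply/asboolP.
Qed.

Lemma min_set0 A : A 0 -> min_set A = Fin 0.
Proof.
move=> A0; apply: ele_anti; apply/andP; split; last by case: min_set.
by apply/negPn; rewrite -ele_Fin_succ; apply/negP => /ele_min_set /(_ _ A0).
Qed.

Section Distances.
Variable G : sgraph.
Implicit Types u v : G.

Lemma ele1_dist u v : ele (Fin 1) (dist u v) = (u != v).
Proof.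
apply/idP/idP => [/ele_min_set h|uv].
  by apply/eqP => uv; have := h 0 (ex_intro _ [::] (And3 isT uv erefl)).
by apply/ele_min_set => _ [[|w p] [_ /= uv' <-]] //; rewrite uv' eqxx in uv.
Qed.

(** A walk of length 0 forces equality and one of length 1 forces adjacency. This local criterion
    spares any analysis of longer walks. *)
Lemma ele2_dist u v : ele (Fin 2) (dist u v) = (u != v) && ~~ adj u v.
Proof.
apply/idP/andP => [h|[uv nadj]].
  split; first by rewrite -ele1_dist; apply: ele_trans h.
  apply/negP => uv; suff : 2 <= 1 by [].
  by move/ele_min_set: h; apply; exists [:: v]; split=> //=; rewrite uv.
apply/ele_min_set => _ [[|w [|w' p]] [/= pth lst <-]] //.
  by rewrite lst eqxx in uv.
by move: pth nadj; rewrite lst andbT => ->.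
Qed.

Lemma ecc_ele v b : ele (ecc v) b = [forall u, ele (dist u v) b].
Proof.
(* The neutral element [Fin 0] of the big maximum has to be sent to [true]. *)
have h0 : ele (Fin 0) b by case: b.
have -> : ele (ecc v) b = \big[andb/true]_(u : G) ele (dist u v) b.
  by apply: (big_morph (ele^~ b)) => // x y; apply: emax_ele.
by rewrite big_andE.
Qed.

Lemma ele_radius b : ele b (radius G) = [forall v : G, ele b (ecc v)].
Proof.
have -> : ele b (radius G) = \big[andb/true]_(v : G) ele b (ecc v).
  by apply: (big_morph (ele b)) => [x y|]; [apply: ele_emin | case: b].
by rewrite big_andE.
Qed.

Lemma ele_ecc_succ n v :
  ele (Fin n.+1) (ecc v) = [exists u, ele (Fin n.+1) (dist u v)].
Proof.
rewrite ele_Fin_succ ecc_ele negb_forall.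
by apply: eq_existsb => u; rewrite ele_Fin_succ.
Qed.

End Distances.

Section Cone.
Variable P : sgraph.

Definition cone_adj : rel (option P) := fun x y =>
  match x, y with
  | Some u, Some v => adj u v
  | None, None => false
  | _, _ => true
  end.

Lemma cone_adj_sym : symmetric cone_adj.
Proof. by case=> [u|] [v|] //=; apply: adj_sym. Qed.

Lemma cone_adj_irrefl : irreflexive cone_adj.
Proof. by case=> [u|] //=; apply: adj_irrefl. Qed.

Definition cone : sgraph := SGraph cone_adj_sym cone_adj_irrefl.

Let apex : cone := None.

Hypothesis P_gt0 : 0 < #|P|.
Hypothesis radius_ge2 : ele (Fin 2) (radius P).

(** Adjacency of the apex to all other vertices gives the upper bound. The lower bound uses [P_gt0],
    which [radius_ge2] does not imply: the empty graph has radius [Infty]. *)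
Lemma ecc_apex : ecc apex = Fin 1.
Proof.
apply: ele_anti; apply/andP; split.
  rewrite ecc_ele; apply/forallP => u; apply/negPn.
  by rewrite -ele_Fin_succ ele2_dist; case: u.
have [x _] := card_gt0P P_gt0.
by rewrite ele_ecc_succ; apply/existsP; exists (Some x); rewrite ele1_dist.
Qed.

(** Distances may shrink in the cone, but being at distance at least 2 only means distinct and
    non-adjacent, and this passes from [P] to its copy. *)
Lemma ele2_ecc_base (v : P) : ele (Fin 2) (ecc (Some v : cone)).
Proof.
have := radius_ge2; rewrite ele_radius => /forallP /(_ v).
rewrite !ele_ecc_succ => /existsP [u]; rewrite ele2_dist => uv.
by apply/existsP; exists (Some u); rewrite ele2_dist.
Qed.

Lemma radius_cone : radius cone = Fin 1.
Proof.
apply: ele_anti; apply/andP; split.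
  rewrite -ecc_apex.
  (* Expanding the right-hand radius by [ele_radius] bounds it by every eccentricity. *)
  have : ele (radius cone) (radius cone) by case: radius => //= n.
  by rewrite ele_radius => /forallP /(_ apex).
rewrite ele_radius; apply/forallP; case=> [v|]; last by rewrite ecc_apex.
exact: ele_trans (ele2_ecc_base v).
Qed.

Lemma center_cone : center cone = [set apex].
Proof.
apply/setP => x; rewrite !inE radius_cone; case: x => [v|].
  by have := ele2_ecc_base v; case: eqP => // ->.
by rewrite ecc_apex !eqxx.
Qed.

Lemma CP_cone : CP cone = ~: [set apex].
Proof.
rewrite /CP center_cone big_set1; apply/setP => x; rewrite !inE ecc_apex.
(* Together these two tests fix the distance: 0 at the apex, exactly 1 elsewhere. *)
have := ele1_dist apex x; have := ele2_dist apex x.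
rewrite [x == _]eq_sym; case: (eqVneq apex x) => [_|ax] /=.
  by case: dist => [[]|].
by case: x ax => //= x _; case: dist => [[|[]]|].
Qed.

Lemma ucg_cone : ucg cone.
Proof. by rewrite /ucg center_cone => c c' /set1P -> /set1P ->. Qed.

Lemma intermediate_cone : intermediate cone = set0.
Proof. by rewrite /intermediate center_cone CP_cone setUCr setCT. Qed.

Lemma iso_CP_cone : iso (induced (CP cone)) P.
Proof.
have [x0 _] := card_gt0P P_gt0.
have inCP (x : P) : (Some x : cone) \in CP cone by rewrite CP_cone !inE.
(* The default [x0] is never returned, since [CP_cone] excludes [None]. *)
exists (fun x : induced (CP cone) => odflt x0 (val x)); split.
  exists (fun x => Sub (Some x) (inCP x) : induced (CP cone)) => //.
  case=> [[x|] xCP]; first exact: val_inj.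
  by exfalso; move: xCP; rewrite CP_cone !inE.
case=> [[x|] xCP] [[y|] yCP] //=;
  by exfalso; move: xCP yCP; rewrite CP_cone !inE.
Qed.

Lemma card_center_cone : #|induced (center cone)| = 1.
Proof. by rewrite card_sig center_cone cards1. Qed.

End Cone.

Lemma iso_card1 (G H : sgraph) : #|G| = 1 -> #|H| = 1 -> iso G H.
Proof.
move=> /eqP/fintype1P [x Gx] /eqP/fintype1P [y Hy].
exists (fun=> y); split; first by exists (fun=> x) => z; rewrite (Gx, Hy).
by move=> a b; rewrite (Gx a) (Gx b) !adj_irrefl.
Qed.

Theorem theorem6p1 (C P : sgraph) (hC : #|C| = 1) (hP : 0 < #|P|)
  (hr : ele (Fin 2) (radius P)) : A_ucg C P = Fin 0.
Proof.
(* As 0 is the least possible value, a single witness settles the minimum. *)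
apply: min_set0; exists (cone P); split.
- exact: ucg_cone.
- exact: iso_card1 (card_center_cone hP hr) hC.
- exact: iso_CP_cone.
- by rewrite intermediate_cone // cards0.
Qed.
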